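(* There exist a constant $c>0$ and a sequence of sets $S_k\subseteq\mathbb{N}$ ($k\geq 1$) with $|S_k|=k+2$ such that $z_{S_k}\geq c\sqrt{k}$ for all sufficiently large $k$.
   Context: $\mathbb{N}=\{0,1,2,\dots\}$. For a finite nonempty set $S=\{e_1,\dots,e_k\}\subseteq\mathbb{N}$ (distinct elements), let $f_S(x)=\sum_{i=1}^k a_i x^{e_i}$, where $a_1,\dots,a_k$ are independent standard normal random variables. For an open interval $I\subseteq(0,\infty)$, $z_S^I$ denotes the expected number of zeros of $f_S$ in $I$, and $z_S:=z_S^{(0,1)}$. *)

(* Defs.v *)
From HB Require Import structures.
From mathcomp Require Import all_boot all_order all_algebra.
From mathcomp Require Import all_classical all_reals all_analysis.
Set Implicit Arguments. Unset Strict Implicit. Unset Printing Implicit Defensive.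
Import Order.TTheory GRing.Theory Num.Theory.
Local Open Scope classical_set_scope.
Local Open Scope ring_scope.

(* f_S(x) = sum_i a_i x^(e_i), exponents given as a duplicate-free list es
   and coefficients as a list a (paired positionally). *)
Definition fS {R : realType} (es : seq nat) (a : seq R) (x : R) : R :=
  \sum_(i < size es) nth 0 a i * x ^+ nth 0%N es i.

Definition nzeros {R : realType} (f : R -> R) (l u : R) : \bar R :=
  counting [set x : R | l < x < u /\ f x = 0].

(* Expectation of a nonnegative functional F of n i.i.d. standard normal
   variables a_1,...,a_n, as the iterated integral against N(0,1)
   (Tonelli: equal to the integral against the product measure). *)
Fixpoint gauss_expect {R : realType} (n : nat) (F : seq R -> \bar R) : \bar R :=
  match n with
  | 0 => F [::]
  | n.+1 => (\int[normal_prob 0 1]_(t in setT)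
               gauss_expect n (fun s => F (t :: s)))%E
  end.

Definition zSI {R : realType} (es : seq nat) (l u : R) : \bar R :=
  gauss_expect (size es) (fun a => nzeros (fS es a) l u).

Definition zS {R : realType} (es : seq nat) : \bar R := zSI es 0 1.

(* Main.v *)
(* With S = {b^0, b^2, ..., b^(2(n-1))}, n = k + 2, b = 100 n, and the nodes
   x_j = 1 - b^-(2j+1), the matrix x_j^(b^(2i)) is within 1/b of the 0/1 matrix
   of the relation i <= j.  Hence f(x_j) is close to the Gaussian random walk
   a_0 + ... + a_j, which changes sign at step j with probability of order
   1/sqrt j; summing over j < k gives order sqrt k zeros.
   The probability of a sign change between U = f(x_j) and V = f(x_(j+1)) is
   bounded below through
     1[U V < 0] >= exp(-(U+V)^2) - exp(-(U^2 + U V + V^2)),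
   whose right-hand side is negative when U V > 0.  Both exponents are quadratic
   forms, so both expectations are inverse square roots of determinants, and
   these differ by a constant factor, the determinants being of order j. *)
Require Import Defs.
From HB Require Import structures.
From mathcomp Require Import all_boot all_order all_algebra.
From mathcomp Require Import all_classical all_reals all_analysis.
From mathcomp Require Import measurable_realfun ring lra.
Import Order.TTheory GRing.Theory Num.Theory.
Import numFieldNormedType.Exports HBNNSimple.
Local Open Scope ring_scope.

(** * Comparison of integrals without measurability of the larger function *)

(** The integral of a nonnegative function is a supremum over the simple functions below it, hence
    monotone. The zero count is nowhere shown to be measurable in the coefficients. *)
Lemma ge0_le_integral_nonmeasurable d (T : measurableType d) (R : realType)
    (mu : {measure set T -> \bar R}) (f g : T -> \bar R) :
  (forall x, 0 <= f x)%E -> (forall x, f x <= g x)%E ->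
  (\int[mu]_x f x <= \int[mu]_x g x)%E.
Proof.
move=> f0 fg.
rewrite !ge0_integralTE//; last by move=> x; exact: le_trans (fg x).
apply: ereal_sup_le => _ [h /= hf <-]; exists h => // x.
exact: le_trans (fg x).
Qed.

Lemma integrable_le_integral_nonmeasurable d (T : measurableType d) (R : realType)
    (mu : {measure set T -> \bar R}) (f g : T -> \bar R) :
  mu.-integrable setT f -> (forall x, 0 <= g x)%E -> (forall x, f x <= g x)%E ->
  (\int[mu]_x f x <= \int[mu]_x g x)%E.
Proof.
move=> fi g0 fg.
(* As [g] is nonnegative, it also dominates the positive part of [f]. *)
apply: (@le_trans _ _ (\int[mu]_x (f^\+ x))%E).
  apply: le_integral => //; first exact: integrable_funepos.
  by move=> x _; rewrite funeposE le_max lexx.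
apply: ge0_le_integral_nonmeasurable => x; first exact: funepos_ge0.
by rewrite funeposE ge_max fg g0.
Qed.

(** * Gaussian integrals in one variable *)

Section normal_integral.
Context {R : realType}.
Local Notation mu := (@lebesgue_measure R).

(** The Radon-Nikodym derivative of the normal law and [normal_pdf] have equal integrals over every
    measurable set, hence agree almost everywhere. *)
Lemma ge0_integral_normal_prob (m s : R) (f : measurableTypeR R -> \bar R) :
  (forall x, 0 <= f x)%E -> measurable_fun setT f ->
  (\int[normal_prob m s]_x f x = \int[mu]_x (f x * (normal_pdf m s x)%:E))%E.
Proof.
move=> f0 mf.
have dom := @normal_prob_dominates R m s.
rewrite -(Radon_Nikodym_SigmaFinite.change_of_variables dom)//.
apply: ae_eq_integral => //.
- apply: emeasurable_funM => //; apply: (measurable_int mu).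
  exact: Radon_Nikodym_SigmaFinite.f_integrable.
- apply: emeasurable_funM => //; apply/measurable_EFinP.
  exact: measurable_normal_pdf.
- apply: ae_eqe_mul2l.
  apply: integral_ae_eq => //.
  + exact: Radon_Nikodym_SigmaFinite.f_integrable.
  + apply/measurable_EFinP; exact: measurable_normal_pdf.
  + by move=> E _ mE; rewrite -Radon_Nikodym_SigmaFinite.f_integral.
Qed.

Lemma measurable_expR_quad (a b c : R) :
  measurable_fun setT (fun t : measurableTypeR R =>
    expR (- (a * t ^+ 2 + 2 * b * t + c) / 2)).
Proof.
apply: continuous_measurable_fun => t.
apply: continuous_comp; last exact: continuous_expR.
apply: cvgM; last exact: cvg_cst.
apply: cvgN; apply: cvgD; last exact: cvg_cst.
apply: cvgD; apply: cvgM; try exact: cvg_cst; last exact: cvg_id.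
exact: exprn_continuous.
Qed.

Lemma integral_normal_expR_quad (a b c : R) : 0 < 1 + a ->
  (\int[normal_prob 0 1]_t (expR (- (a * t ^+ 2 + 2 * b * t + c) / 2))%:E =
   ((Num.sqrt (1 + a))^-1 * expR (- (c - b ^+ 2 / (1 + a)) / 2))%:E)%E.
Proof.
move=> a0.
rewrite ge0_integral_normal_prob; first last.
- by apply/measurable_EFinP; exact: measurable_expR_quad.
- by move=> x; rewrite lee_fin expR_ge0.
(* Completing the square turns the integrand times the standard density into [K] times the normal
   density of mean [m] and standard deviation [s]. *)
set s := (Num.sqrt (1 + a))^-1; set m := - b / (1 + a).
have s0 : 0 < s by rewrite invr_gt0 sqrtr_gt0.
have s2 : s ^+ 2 = (1 + a)^-1 by rewrite exprVn sqr_sqrtr// ltW.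
have pi2 : 0 < pi *+ 2 :> R by rewrite mulrn_wgt0// pi_gt0.
set K := _ * expR _.
have pt (t : R) : (expR (- (a * t ^+ 2 + 2 * b * t + c) / 2) * normal_pdf 0 1 t
   = K * normal_pdf m s t).
  rewrite !normal_pdfE ?oner_neq0 ?gt_eqF//.
  rewrite /normal_peak /normal_fun /K.
  have -> : Num.sqrt (s ^+ 2 * pi *+ 2) = s * Num.sqrt (pi *+ 2).
    by rewrite -mulrnAr sqrtrM ?sqr_ge0// sqrtr_sqr gtr0_norm.
  rewrite expr1n mul1r mulrCA -expRD invfM.
  rewrite [RHS](_ : _ = (s * s^-1) * ((Num.sqrt (pi *+ 2))^-1 *
    (expR (- (c - b ^+ 2 / (1 + a)) / 2) * expR (- (t - m) ^+ 2 / (s ^+ 2 *+ 2)))));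
    last by ring.
  rewrite divff ?gt_eqF// mul1r -expRD; congr (_ * expR _).
  rewrite s2 /m; field.
  by rewrite gt_eqF.
under eq_integral do rewrite -EFinM pt EFinM.
by rewrite integralZl// ?integral_normal_pdf ?mule1//; exact: integrable_normal_pdf.
Qed.

Lemma integrable_normal_expR_quad (a b c : R) : 0 < 1 + a ->
  (normal_prob 0 1).-integrable setT
    (fun t : measurableTypeR R => (expR (- (a * t ^+ 2 + 2 * b * t + c) / 2))%:E).
Proof.
move=> a0; apply/integrableP; split.
  by apply/measurable_EFinP; exact: measurable_expR_quad.
under eq_integral do rewrite gee0_abs ?lee_fin ?expR_ge0//.
by rewrite integral_normal_expR_quad// ltry.
Qed.

End normal_integral.

(** * Expectations of exponentials of quadratic forms in two linear forms *)

Section gaussian_forms.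
Context {R : realType}.
Implicit Types (A B C p q r y z t : R) (u v : nat -> R) (n : nat).

(** The form with matrix [[[A, C], [C, B]]]; the off-diagonal entry is the last of the three
    coefficients. *)
Definition quad A B C y z := A * y ^+ 2 + 2 * C * y * z + B * z ^+ 2.

Lemma quad_ge0 A B C y z : 0 <= A -> 0 <= B -> C ^+ 2 <= A * B ->
  0 <= quad A B C y z.
Proof.
move=> A0 B0 CAB; rewrite /quad.
have [A_eq0|A_neq0] := eqVneq A 0.
  have C0 : C = 0.
    by apply/eqP; rewrite -sqrf_eq0 eq_le sqr_ge0 andbT (le_trans CAB)// A_eq0 mul0r.
  by rewrite A_eq0 C0 mulr0 !mul0r !add0r mulr_ge0 ?sqr_ge0.
have Apos : 0 < A by rewrite lt_def A_neq0.
rewrite -(pmulr_rge0 _ Apos).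
have -> : A * (A * y ^+ 2 + 2 * C * y * z + B * z ^+ 2) =
  (A * y + C * z) ^+ 2 + (A * B - C ^+ 2) * z ^+ 2 by ring.
by rewrite addr_ge0 ?sqr_ge0// mulr_ge0 ?sqr_ge0// subr_ge0.
Qed.

Definition dotn n u v := \sum_(i < n) u i * v i.

Lemma dotnS n u v :
  dotn n.+1 u v = u 0 * v 0 + dotn n (u \o S) (v \o S).
Proof. by rewrite /dotn big_ord_recl. Qed.

Lemma dotn_ge0 n u : 0 <= dotn n u u.
Proof. by apply: sumr_ge0 => i _; rewrite -expr2 sqr_ge0. Qed.

Lemma dotn_CauchySchwarz n u v :
  dotn n u v ^+ 2 <= dotn n u u * dotn n v v.
Proof.
elim: n u v => [|n IH] u v; first by rewrite /dotn !big_ord0 mul0r expr0n.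
rewrite !dotnS.
(* This form collects the cross terms that separate the inequality for [n.+1] from the one for
   [n]. *)
have := @quad_ge0 _ _ (- dotn n (u \o S) (v \o S)) (v 0) (u 0)
  (dotn_ge0 n (u \o S)) (dotn_ge0 n (v \o S)).
rewrite sqrrN => /(_ (IH _ _)); rewrite /quad.
move: (IH (u \o S) (v \o S)).
move: (dotn n (u \o S) (v \o S)) (dotn n (u \o S) (u \o S))
  (dotn n (v \o S) (v \o S)) => q p r.
move: (u 0) (v 0) => a b; nra.
Qed.

(* The determinant of [1 + M G] for [M = [[A, C], [C, B]]], [G = [[p, q], [q, r]]]. *)
Definition gdet A B C p q r :=
  1 + A * p + 2 * C * q + B * r + (A * B - C ^+ 2) * (p * r - q ^+ 2).

Definition gdetn n A B C u v :=
  gdet A B C (dotn n u u) (dotn n u v) (dotn n v v).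

Lemma sum_quad n A B C u v :
  \sum_(i < n) quad A B C (u i) (v i) =
  A * dotn n u u + 2 * C * dotn n u v + B * dotn n v v.
Proof.
rewrite /dotn !mulr_sumr -!big_split/=; apply: eq_bigr => i _.
by rewrite /quad; ring.
Qed.

(** Beyond the leading 1, the linear terms are a sum of nonnegative values of [quad], and the last
    term is a product of two nonnegative determinants, that of [G] by Cauchy-Schwarz. *)
Lemma gdetn_gt0 n A B C u v : 0 <= A -> 0 <= B -> C ^+ 2 <= A * B ->
  0 < gdetn n A B C u v.
Proof.
move=> A0 B0 CAB; rewrite /gdetn /gdet -addrA -addrA -addrA ltr_pwDl//.
rewrite !addrA addr_ge0//.
  by rewrite -sum_quad; apply: sumr_ge0 => i _; exact: quad_ge0.
by rewrite mulr_ge0// subr_ge0// dotn_CauchySchwarz.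
Qed.

(* Completing the square one variable at a time turns the matrix M of the form
   into (M^-1 + G)^-1, with G the Gram matrix of u and v; multiplied by the
   determinant, its entries stay polynomial even when M is singular. *)
Definition gauss_quad n A B C u v y z :=
  let d := A * B - C ^+ 2 in
  let D := gdetn n A B C u v in
  (Num.sqrt D)^-1 *
  expR (- quad ((A + d * dotn n v v) / D) ((B + d * dotn n u u) / D)
          ((C - d * dotn n u v) / D) y z / 2).

Lemma gauss_quad0 A B C u v y z :
  gauss_quad 0 A B C u v y z = expR (- quad A B C y z / 2).
Proof.
have D1 : gdetn 0 A B C u v = 1 by rewrite /gdetn /gdet /dotn !big_ord0; ring.
rewrite /gauss_quad D1 /dotn !big_ord0.
by rewrite !(mulr0, addr0, subr0, sqrtr1, invr1, mul1r, mulr1).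
Qed.

(** A variable with coefficients [a], [b] adds a rank-one matrix to [G]. The first identity is the
    matrix determinant lemma, the second the Sherman-Morrison formula. *)
Lemma gdet_step A B C p q r a b y z (d := A * B - C ^+ 2)
    (D := gdet A B C p q r)
    (D' := gdet A B C (a * a + p) (a * b + q) (b * b + r))
    (A' := (A + d * r) / D) (B' := (B + d * p) / D) (C' := (C - d * q) / D) :
  D != 0 -> D' != 0 ->
  1 + quad A' B' C' a b = D' / D /\
  quad A' B' C' y z -
    (A' * y * a + C' * (y * b + z * a) + B' * z * b) ^+ 2 / (D' / D) =
  quad ((A + d * (b * b + r)) / D') ((B + d * (a * a + p)) / D')
    ((C - d * (a * b + q)) / D') y z.
Proof.
rewrite /A' /B' /C' /D' /D /quad /d /gdet => D0 D'0; split.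
  by field.
by field; rewrite D0 D'0.
Qed.

Lemma integral_gauss_quadS n A B C u v y z : 0 <= A -> 0 <= B -> C ^+ 2 <= A * B ->
  let f t := gauss_quad n A B C (u \o S) (v \o S) (y + t * u 0) (z + t * v 0) in
  (normal_prob 0 1).-integrable setT (fun t : measurableTypeR R => (f t)%:E) /\
  (\int[normal_prob 0 1]_t (f t)%:E = (gauss_quad n.+1 A B C u v y z)%:E)%E.
Proof.
move=> A0 B0 CAB f.
set d := A * B - C ^+ 2.
set p := dotn n (u \o S) (u \o S).
set q := dotn n (u \o S) (v \o S).
set r := dotn n (v \o S) (v \o S).
set D := gdetn n A B C (u \o S) (v \o S).
set D' := gdetn n.+1 A B C u v.
have D_gt0 : 0 < D by exact: gdetn_gt0.
have D'_gt0 : 0 < D' by exact: gdetn_gt0.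
have D'E : D' = gdet A B C (u 0 * u 0 + p) (u 0 * v 0 + q) (v 0 * v 0 + r).
  by rewrite /D' /gdetn !dotnS.
set A' := (A + d * r) / D; set B' := (B + d * p) / D.
set C' := (C - d * q) / D.
have [] := @gdet_step A B C p q r (u 0) (v 0) y z.
- by rewrite gt_eqF.
- by rewrite -D'E gt_eqF.
rewrite -D'E -/d -[gdet _ _ _ p q r]/D -/A' -/B' -/C' => E1 E2.
(* The form at [(y + t * u 0, z + t * v 0)] has [a] as coefficient of [t ^+ 2] and [2 * b] as
   coefficient of [t]. *)
pose a := quad A' B' C' (u 0) (v 0).
pose b := A' * y * u 0 + C' * (y * v 0 + z * u 0) + B' * z * v 0.
have fE : (fun t : measurableTypeR R => (f t)%:E) =
    (fun t : measurableTypeR R => (Num.sqrt D)^-1%:E *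
       (expR (- (a * t ^+ 2 + 2 * b * t + quad A' B' C' y z) / 2))%:E)%E.
  apply/funext => t; rewrite -EFinM; congr (_ * expR (- _ / 2))%:E.
  by rewrite -/D -/p -/q -/r -/d -/A' -/B' -/C' /a /b /quad; ring.
have a0 : 0 < 1 + a by rewrite E1 divr_gt0.
rewrite fE; split.
  by apply: integrableZl => //; exact: integrable_normal_expR_quad.
rewrite integralZl//; last exact: integrable_normal_expR_quad.
rewrite integral_normal_expR_quad// -EFinM mulrA; congr (_ * _)%:E.
  rewrite -invfM -sqrtrM ?(ltW D_gt0)// E1.
  by rewrite mulrCA divff ?gt_eqF// mulr1.
by rewrite E1 E2 -/D' !dotnS.
Qed.

Lemma gauss_expect_ge0 n (F : seq R -> \bar R) :
  (forall s, 0 <= F s)%E -> (0 <= gauss_expect n F)%E.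
Proof.
elim: n F => [|n IH] F F0 /=; first exact: F0.
by apply: integral_ge0 => t _; apply: IH => s.
Qed.

(* [F] need not be measurable: at every stage of the iterated integral the
   minorant is an explicit integrable function. *)
Lemma gauss_expect_ge n (F : seq R -> \bar R) (I : Type) (J : seq I)
    (w A B C : I -> R) (u v : I -> nat -> R) (y z : I -> R) :
  (forall i, 0 <= A i) -> (forall i, 0 <= B i) ->
  (forall i, C i ^+ 2 <= A i * B i) ->
  (forall s, 0 <= F s)%E ->
  (forall s, size s = n ->
    ((\sum_(i <- J) w i * expR (- quad (A i) (B i) (C i)
       (y i + dotn n (nth 0 s) (u i)) (z i + dotn n (nth 0 s) (v i)) / 2))%:E
     <= F s)%E) ->
  ((\sum_(i <- J) w i * gauss_quad n (A i) (B i) (C i) (u i) (v i) (y i) (z i))%:E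
   <= gauss_expect n F)%E.
Proof.
move=> A0 B0 CAB; elim: n F u v y z => [|n IH] F u v y z F0 FJ /=.
  apply: le_trans (FJ [::] erefl); rewrite lee_fin le_eqVlt; apply/orP; left.
  by apply/eqP/eq_bigr => i _; rewrite gauss_quad0 /dotn !big_ord0 !addr0.
pose g i (t : measurableTypeR R) :=
  ((w i)%:E * (gauss_quad n (A i) (B i) (C i) (u i \o S) (v i \o S)
                 (y i + t * u i 0) (z i + t * v i 0))%:E)%E.
have gi i : (normal_prob 0 1).-integrable setT (g i).
  apply: integrableZl => //.
  by have [] := integral_gauss_quadS n _ _ _ (u i) (v i) (y i) (z i)
    (A0 i) (B0 i) (CAB i).
apply: (@le_trans _ _ (\int[normal_prob 0 1]_t (\sum_(i <- J) g i t))%E).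
  rewrite integral_sum// -sumEFin; apply: lee_sum => i _.
  have [I1 I2] := integral_gauss_quadS n _ _ _ (u i) (v i) (y i) (z i)
    (A0 i) (B0 i) (CAB i).
  by rewrite integralZl// I2 EFinM.
apply: integrable_le_integral_nonmeasurable.
- exact: integrable_sum.
- by move=> t; apply: gauss_expect_ge0.
move=> t.
under eq_bigr do rewrite /g -EFinM.
rewrite sumEFin; apply: IH => // s sn.
apply: le_trans (FJ (t :: s) _); last by rewrite /= sn.
rewrite lee_fin le_eqVlt; apply/orP; left; apply/eqP/eq_bigr => i _.
by rewrite !dotnS /= !addrA.
Qed.

End gaussian_forms.

(** * Zeros from sign changes *)

Section zeros.
Context {R : realType}.

(** The intermediate value theorem puts a zero inside each interval with a sign change, and disjoint
    open intervals give distinct zeros. An infinite zero set has count [+oo]. *)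
Lemma sign_changes_le_nzeros (f : R -> R) (x : nat -> R) (m : nat) (l u : R) :
  continuous f -> {homo x : i j / (i < j)%N >-> i < j} ->
  (forall i, l < x i < u) ->
  ((\sum_(i < m) ((f (x i) * f (x i.+1) < 0)%R : nat)%:R)%:E
   <= nzeros f l u)%E.
Proof.
move=> cf xincr xlu.
rewrite /nzeros /counting; case: ifPn; last by rewrite leey.
move=> /asboolP finZ.
have /choice[z zP] : forall i, exists z,
    f (x i) * f (x i.+1) < 0 -> x i < z < x i.+1 /\ f z = 0.
  (* The value 0 is a mere default where there is no sign change. *)
  move=> i; have [sc|] := boolP (f (x i) * f (x i.+1) < 0); last by exists 0.
  have [|||c] := @IVT R f (x i) (x i.+1) 0.
  - exact/ltW/xincr.
  - exact/continuous_subspaceT.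
  - rewrite ge_min le_max; move: sc.
    case: (leP (f (x i)) 0) => a0; case: (leP (f (x i.+1)) 0) => b0 //=.
    + by rewrite ltNge mulr_le0.
    + by rewrite (ltW b0) orbT.
    + by rewrite (ltW a0).
    + by rewrite ltNge mulr_ge0// ltW.
  rewrite in_itv/= => /andP[ac cb] fc; exists c => _; split=> //.
  (* The zero is not an endpoint, since [f] vanishes at neither. *)
  move: sc; rewrite !lt_neqAle ac cb !andbT => /andP[sc _].
  apply/andP; split; apply: contraNneq sc => h.
    by rewrite h fc mul0r.
  by rewrite -h fc mulr0.
have zinj i j : f (x i) * f (x i.+1) < 0 -> f (x j) * f (x j.+1) < 0 ->
    z i = z j -> i = j.
  have H a b : (a < b)%N -> f (x a) * f (x a.+1) < 0 ->
      f (x b) * f (x b.+1) < 0 -> z a < z b.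
    move=> ab /zP[/andP[_ za] _] /zP[/andP[zb _] _].
    apply: (lt_trans za); apply: le_lt_trans zb.
    by move: ab; rewrite leq_eqVlt => /predU1P[->//|/xincr/ltW].
  move=> hi hj zij; have [ij|ji|//] := ltngtP i j.
    by have := H _ _ ij hi hj; rewrite zij ltxx.
  by have := H _ _ ji hj hi; rewrite zij ltxx.
pose J := [seq i <- iota 0 m | f (x i) * f (x i.+1) < 0].
have JP i : i \in J -> f (x i) * f (x i.+1) < 0.
  by rewrite mem_filter => /andP[].
have -> : \sum_(i < m) ((f (x i) * f (x i.+1) < 0)%R : nat)%:R = (size J)%:R :> R.
  rewrite -natr_sum -(big_mkord xpredT (fun i => (f (x i) * f (x i.+1) < 0)%R : nat)).
  rewrite size_filter -sum1_count [in RHS]big_mkcond /index_iota subn0.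
  by congr _%:R; apply: eq_bigr => i _; case: ifP.
rewrite lee_fin ler_nat -(size_map z); apply: uniq_leq_size.
  rewrite map_inj_in_uniq ?filter_uniq ?iota_uniq//.
  by move=> i j /JP hi /JP hj; exact: zinj.
move=> c /mapP[i /JP/zP[/andP[h1 h2] fz] ->].
rewrite in_fset_set// inE /=; split=> //.
have /andP[lx _] := xlu i; have /andP[_ xu] := xlu i.+1.
by rewrite (lt_trans lx h1) (lt_trans h2 xu).
Qed.

Lemma continuous_fS es (a : seq R) : continuous (fS es a).
Proof.
rewrite /fS; apply: continuous_big; first exact: add_continuous.
move=> i _ x; apply: cvgM; first exact: cvg_cst.
exact: exprn_continuous.
Qed.

(** The halved forms are [(U + V) ^+ 2] and [U ^+ 2 + U * V + V ^+ 2], which differ by [U * V]. For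
    [U * V < 0] it suffices that the first exponential is at most 1. *)
Lemma expR_quad_le_sign_change (U V : R) :
  expR (- quad 2 2 2 U V / 2) - expR (- quad 2 2 1 U V / 2) <=
  ((U * V < 0)%R : nat)%:R.
Proof.
have [neg|pos] /= := boolP (U * V < 0).
  rewrite lerBlDr (@le_trans _ _ 1)// ?lerDl ?expR_ge0//.
  rewrite -expR0 ler_expR mulNr oppr_le0 divr_ge0//.
  by apply: quad_ge0 => //; rewrite expr2.
by rewrite subr_le0 ler_expR; move: pos; rewrite -leNgt /quad; nra.
Qed.

End zeros.

(** * Estimates of determinants and powers *)

Section numerics.
Context {R : realType}.

Lemma sum_threshold_ge (F : nat -> R) (c : R) (m n : nat) : (m <= n)%N ->
  (forall i, (i < m)%N -> c <= F i) -> (forall i, 0 <= F i) ->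
  m%:R * c <= \sum_(i < n) F i.
Proof.
move=> mn Fc F0; rewrite -(big_mkord xpredT F) (big_cat_nat (leq0n m) mn)//= big_mkord.
rewrite -[leLHS]addr0 lerD ?sumr_ge0//.
rewrite mulr_natl -[m in leLHS]card_ord -sumr_const.
by apply: ler_sum => i _; apply: Fc.
Qed.

Lemma sum_threshold_le (F : nat -> R) (c eps : R) (m n : nat) : (m <= n)%N ->
  0 <= eps ->
  (forall i, (i < m)%N -> F i <= c) -> (forall i, (m <= i)%N -> F i <= eps) ->
  \sum_(i < n) F i <= m%:R * c + n%:R * eps.
Proof.
move=> mn e0 Fc Fe; rewrite -(big_mkord xpredT F) (big_cat_nat (leq0n m) mn)//= big_mkord.
apply: lerD.
  rewrite mulr_natl -[m in leRHS]card_ord -sumr_const.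
  by apply: ler_sum => i _; apply: Fc.
apply: (@le_trans _ _ (\sum_(m <= i < n) eps)).
  by rewrite big_nat_cond [leRHS]big_nat_cond; apply: ler_sum => i /andP[/andP[/Fe]].
by rewrite sumr_const_nat -[eps *+ _]mulr_natl ler_wpM2r// ler_nat leq_subr.
Qed.

(** Here [u] and [v] are nearly the indicators of [i <= j] and [i <= j.+1], so [w = v - u] is nearly
    that of [j.+1]. Thus [p], [s], [W] are close to [j.+1], 0, 1. *)
Lemma gdetn_threshold (n j : nat) (eps : R) (u v : nat -> R) :
  (j.+1 < n)%N -> 0 <= eps -> n%:R * eps <= 1 / 100 ->
  (forall i, 0 <= u i) -> (forall i, u i <= v i) -> (forall i, v i <= 1) ->
  (forall i, (i <= j)%N -> 1 - eps <= u i) ->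
  (forall i, (j < i)%N -> u i <= eps) ->
  1 - eps <= v j.+1 ->
  (forall i, (j.+1 < i)%N -> v i <= eps) ->
  gdetn n 2 2 2 u v <= 25 * j.+1%:R /\
  gdetn n 2 2 2 u v + 7 / 10 * j.+1%:R <= gdetn n 2 2 1 u v.
Proof.
move=> jn e0 ne u0 uv v1 u_lo u_hi v_lo v_hi.
pose w i := v i - u i.
have w0 i : 0 <= w i by rewrite subr_ge0.
have e100 : eps <= 1 / 100.
  apply: le_trans ne; rewrite ler_peMl// ler1n; exact: leq_ltn_trans jn.
pose p := dotn n u u; pose s := dotn n u w; pose W := dotn n w w.
have qE : dotn n u v = p + s.
  by rewrite /p /s /dotn -big_split; apply: eq_bigr => i _ /=; rewrite /w; ring.
have rE : dotn n v v = p + 2 * s + W.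
  rewrite /p /s /W /dotn mulr_sumr -!big_split; apply: eq_bigr => i _ /=.
  by rewrite /w; ring.
have p_lo : j.+1%:R * (1 - eps) ^+ 2 <= p.
  apply: (sum_threshold_ge (fun i => u i * u i)); first exact: ltnW.
    by move=> i ij; have := u_lo i ij; nra.
  by move=> i; rewrite mulr_ge0.
have s_lo : 0 <= s by apply: sumr_ge0 => i _; rewrite mulr_ge0.
have s_hi : s <= 1 / 100.
  apply: (@le_trans _ _ (0%:R * 0 + n%:R * eps)); last by rewrite mul0r add0r.
  apply: (sum_threshold_le (fun i => u i * w i)) => // i _.
  have [ij|ij] := leqP i j.
    by have := u_lo i ij; have := v1 i; have := u0 i; have := w0 i;
      have := uv i; rewrite /w; nra.
  by have := u_hi i ij; have := v1 i; have := u0 i; have := uv i; rewrite /w; nra.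
have W_lo : (1 - 2 * eps) ^+ 2 <= W.
  rewrite /W /dotn (bigD1 (Ordinal jn))//= -[leLHS]addr0 lerD//.
    by have := u_hi j.+1 (ltnSn j); rewrite /w; nra.
  by apply: sumr_ge0 => i _; rewrite mulr_ge0.
have r_hi : p + 2 * s + W <= j.+1%:R + 2.
  rewrite -rE; apply: (@le_trans _ _ (j.+2%:R * 1 + n%:R * eps)); last first.
    by rewrite -[j.+2%:R]natr1; lra.
  apply: (sum_threshold_le (fun i => v i * v i)) => // i ij.
    by have := v1 i; have := u0 i; have := uv i; nra.
  by have := v_hi i ij; have := v1 i; have := u0 i; have := uv i; nra.
have N1 : 1 <= j.+1%:R :> R by rewrite ler1n.
rewrite /gdetn /gdet qE rE -/p.
clear qE rE; clearbody p s W.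
move: (j.+1%:R) p_lo r_hi N1 => N p_lo r_hi N1.
have {}W_lo : 96 / 100 <= W by apply: le_trans W_lo; nra.
have {}p_lo : 98 / 100 * N <= p.
  apply: le_trans p_lo; rewrite mulrC ler_wpM2l//; last by nra.
  by lra.
(* For [C = 2] the matrix is singular and the determinant is [1 + 8 * p + 8 * s + 2 * W], at most
   [8 * N + 17]. *)
split; first by lra.
(* The determinants differ by [3 * p * W - 2 * p - 2 * s - 3 * s ^+ 2], which is about [N]. *)
have : 0 <= p * (W - 96 / 100) by apply: mulr_ge0; lra.
by nra.
Qed.

Lemma inv_sqrt_gap (N D1 D2 : R) : 1 <= N -> 0 < D1 -> D1 <= 25 * N ->
  D1 + 7 / 10 * N <= D2 ->
  1 / 510 / Num.sqrt N <= (Num.sqrt D1)^-1 - (Num.sqrt D2)^-1.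
Proof.
move=> N1 D10 D1N D12.
have N0 : 0 < N by lra.
have sN0 : 0 < Num.sqrt N by rewrite sqrtr_gt0.
have s10 : 0 < Num.sqrt D1 by rewrite sqrtr_gt0.
(* The ratio [D2 / D1] is at least [1 + 7 / 250], which exceeds the square of [101 / 100]. *)
have s12 : 101 / 100 * Num.sqrt D1 <= Num.sqrt D2.
  rewrite -[101 / 100 in leLHS]gtr0_norm; last by lra.
  by rewrite -sqrtr_sqr -sqrtrM ?sqr_ge0// ler_wsqrtr//; lra.
have s1N : Num.sqrt D1 <= 5 * Num.sqrt N.
  rewrite -[5 in leRHS]gtr0_norm//.
  by rewrite -sqrtr_sqr -sqrtrM ?sqr_ge0// ler_wsqrtr//; lra.
(* The gap is at least [1 / 101] of the inverse root of [D1]; the factor 5 of [s1N] turns [1 / 102]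
   into [1 / 510]. *)
apply: (@le_trans _ _ (1 / 102 * (Num.sqrt D1)^-1)).
  have : (5 * Num.sqrt N)^-1 <= (Num.sqrt D1)^-1.
    by rewrite lef_pV2// posrE mulr_gt0.
  by rewrite invfM; lra.
have : (Num.sqrt D2)^-1 <= (101 / 100 * Num.sqrt D1)^-1.
  by rewrite lef_pV2// posrE ?mulr_gt0//; lra.
rewrite invfM; have : 0 < (Num.sqrt D1)^-1 by rewrite invr_gt0.
by lra.
Qed.

Lemma bernoulli_ge (d : R) m : 0 <= d <= 1 -> 1 - m%:R * d <= (1 - d) ^+ m.
Proof.
move=> /andP[d0 d1]; elim: m => [|m IH]; first by rewrite expr0; lra.
rewrite exprS -natr1.
have : 0 <= (1 - d) * ((1 - d) ^+ m - (1 - m%:R * d)).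
  by apply: mulr_ge0; lra.
have : 0 <= m%:R * (d * d) by rewrite !mulr_ge0.
by nra.
Qed.

(** A division-free upper bound on [(1 - d) ^+ m], small once [m%:R * d] is large; it serves the
    exponents beyond the threshold. *)
Lemma bernoulli_le (d : R) m : 0 <= d <= 1 ->
  (1 - d) ^+ m * (1 + m%:R * d) <= 1.
Proof.
move=> /andP[d0 d1]; elim: m => [|m IH]; first by rewrite expr0; lra.
apply: le_trans IH; rewrite exprS -natr1 -subr_ge0.
have -> : (1 - d) ^+ m * (1 + m%:R * d) -
   (1 - d) * (1 - d) ^+ m * (1 + (m%:R + 1) * d) =
   (1 - d) ^+ m * ((m%:R + 1) * d * d) by ring.
by rewrite !mulr_ge0 ?exprn_ge0 ?subr_ge0.
Qed.

End numerics.

(** * Lacunary exponents and nodes *)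

Section lacunary.
Context {R : realType}.
Variable b : nat.
Hypothesis b_gt1 : (1 < b)%N.

(** Exponents are even powers of [b] and the gaps [1 - node j] inverse odd powers, so exponent times
    gap is [b] to the power [2i - 2j - 1]: at most [1 / b] if [i <= j], at least [b] otherwise. *)
Definition expo (i : nat) : nat := (b ^ (2 * i))%N.
Definition node (j : nat) : R := 1 - b%:R ^- (2 * j).+1.

Let bR_gt1 : 1 < b%:R :> R. Proof. by rewrite ltr1n. Qed.
Let bR_gt0 : 0 < b%:R :> R. Proof. exact: lt_trans ltr01 bR_gt1. Qed.

Lemma node_gap_itv j : 0 < (b%:R ^- (2 * j).+1 : R) < 1.
Proof. by rewrite invr_gt0 exprn_gt0//= invf_lt1 ?exprn_gt0// exprn_egt1. Qed.

Lemma node_itv j : 0 < node j < 1.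
Proof. by have /andP[? ?] := node_gap_itv j; rewrite /node; lra. Qed.

Lemma node_incr : {homo node : i j / (i < j)%N >-> i < j}.
Proof.
move=> i j ij; rewrite /node ltrD2l ltrN2 ltf_pV2 ?posrE ?exprn_gt0//.
by rewrite ltr_eXn2l// ltnS ltn_mul2l.
Qed.

Lemma expo_inj : injective expo.
Proof. by move=> i j /(expnI b_gt1)/eqP; rewrite eqn_mul2l => /eqP. Qed.

Lemma node_expo_ge i j : (i <= j)%N -> 1 - b%:R^-1 <= node j ^+ expo i.
Proof.
move=> ij; have /andP[h0 h1] := node_gap_itv j.
apply: le_trans (bernoulli_ge _ _ _); last by rewrite !ltW.
rewrite lerD2l lerN2 /expo natrX ler_pdivrMr ?exprn_gt0// exprS.
rewrite mulrA mulVf ?gt_eqF// mul1r ler_eXn2l// leq_mul2l ij//.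
Qed.

Lemma node_expo_le i j : (j < i)%N -> node j ^+ expo i <= b%:R^-1.
Proof.
move=> ij; have /andP[h0 h1] := node_gap_itv j.
have /andP[x0 x1] := node_itv j.
have h01 : 0 <= (b%:R ^- (2 * j).+1 : R) <= 1 by rewrite !ltW.
have H := bernoulli_le _ (expo i) h01; rewrite -/(node j) in H.
rewrite -[leRHS]mul1r ler_pdivlMr//; apply: le_trans H.
rewrite ler_wpM2l ?exprn_ge0 ?(ltW x0)//.
apply: ltW; rewrite ltr_pwDl// ler_pdivlMr ?exprn_gt0// /expo natrX -exprS.
by rewrite ler_eXn2l// -addn2 -mulnSr leq_mul2l.
Qed.

End lacunary.

(** * The expected number of sign changes and the final bound *)

Lemma fS_mkseq (R : realType) (e : nat -> nat) n (a : seq R) (x : R) :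
  fS (mkseq e n) a x = dotn n (nth 0 a) (fun i => x ^+ e i).
Proof.
rewrite /fS /dotn.
rewrite -(big_mkord xpredT (fun i => nth 0 a i * x ^+ nth 0%N (mkseq e n) i)).
rewrite size_mkseq big_mkord; apply: eq_bigr => i _.
by rewrite nth_mkseq.
Qed.

(** The values of [fS] at consecutive nodes are two linear forms in the coefficients, so the
    exponential minorant of each sign change has an explicit expectation. *)
Lemma zS_ge_gap (R : realType) (e : nat -> nat) (x : nat -> R) (n m : nat)
    (D := fun c j => gdetn n 2 2 c (fun i => x j ^+ e i) (fun i => x j.+1 ^+ e i)) :
  {homo x : i j / (i < j)%N >-> i < j} -> (forall j, 0 < x j < 1) ->
  ((\sum_(j < m) ((Num.sqrt (D 2 j))^-1 - (Num.sqrt (D 1 j))^-1))%:E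
   <= zS (mkseq e n))%E.
Proof.
move=> x_incr x01; rewrite /zS /zSI size_mkseq.
(* Each step [j] contributes two terms: [true] has weight 1 and [C = 2], [false] has weight -1 and
   [C = 1]. *)
pose J := [seq (i, true) | i <- iota 0 m] ++ [seq (i, false) | i <- iota 0 m].
pose w (i : nat * bool) : R := if i.2 then 1 else -1.
pose c (i : nat * bool) : R := if i.2 then 2 else 1.
have sumJ (F : nat * bool -> R) :
    \sum_(i <- J) w i * F i = \sum_(j < m) (F (j : nat, true) - F (j : nat, false)).
  rewrite /J big_cat !big_map /= /w /=.
  rewrite -(big_mkord xpredT (fun j => F (j, true) - F (j, false))).
  by rewrite /index_iota subn0 -big_split; apply: eq_bigr => j _ /=; rewrite mul1r mulN1r.
have gauss_quad00 (i : nat * bool) :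
    gauss_quad n 2 2 (c i) (fun k => x i.1 ^+ e k) (fun k => x i.1.+1 ^+ e k) 0 0 =
    (Num.sqrt (D (c i) i.1))^-1.
  rewrite /gauss_quad -/(D _ _) [quad _ _ _ 0 0](_ : _ = 0); last by rewrite /quad; ring.
  by rewrite oppr0 mul0r expR0 mulr1.
have := @gauss_expect_ge R n (fun a => nzeros (fS (mkseq e n) a) 0 1) _ J w
  (fun=> 2) (fun=> 2) c (fun i k => x i.1 ^+ e k) (fun i k => x i.1.+1 ^+ e k)
  (fun=> 0) (fun=> 0).
under eq_bigr do rewrite gauss_quad00.
rewrite sumJ; apply => //.
  by move=> [i []] /=; rewrite /c /=; lra.
move=> s _; apply: le_trans (sign_changes_le_nzeros _ _ m _ _ _ x_incr x01).
  rewrite sumJ lee_fin; apply: ler_sum => j _ /=; rewrite !add0r -!fS_mkseq.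
  exact: expR_quad_le_sign_change.
exact: continuous_fS.
Qed.

Theorem theorem1p3 (R : realType) :
  exists c : R, 0 < c /\
  exists S : nat -> seq nat,
    (forall k : nat, (1 <= k)%N -> uniq (S k) /\ size (S k) = (k + 2)%N) /\
    exists K : nat, forall k : nat, (K <= k)%N -> (1 <= k)%N ->
      ((c * Num.sqrt (k%:R))%:E <= zS (S k))%E.
Proof.
exists (1 / 510); split; first by lra.
(* This makes [n] times the error [1 / b] equal to [1 / 100]. *)
pose b k := (100 * (k + 2))%N.
have b_gt1 k : (1 < b k)%N by rewrite /b addn2 mulnS.
exists (fun k => mkseq (expo (b k)) (k + 2)); split.
  move=> k _; rewrite size_mkseq; split=> //.
  by apply/mkseq_uniq/expo_inj.
(* The bound holds for every [k >= 1]. *)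
exists 0%N => k _ k_ge1; set n := (k + 2)%N.
have x_incr := node_incr (R := R) _ (b_gt1 k).
have x_itv := node_itv (R := R) _ (b_gt1 k).
apply: (le_trans _ (zS_ge_gap _ _ _ n k x_incr x_itv)).
have k0 : 0 < k%:R :> R by rewrite ltr0n.
have sk0 : 0 < Num.sqrt (k%:R : R) by rewrite sqrtr_gt0.
(* All [k] terms are bounded below by the bound for the last one, and [k] divided by its root is the
   root. *)
rewrite lee_fin (@le_trans _ _ (\sum_(j < k) 1 / 510 / Num.sqrt k%:R))//.
  rewrite sumr_const card_ord -[leRHS]mulr_natl -{2}[k%:R](@sqr_sqrtr R) ?(ltW k0)//.
  rewrite le_eqVlt; apply/orP; left; apply/eqP.
  by field; rewrite gt_eqF.
apply: ler_sum => j _.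
have bR0 : 0 < (b k)%:R :> R by rewrite ltr0n (ltn_trans _ (b_gt1 k)).
have [] := @gdetn_threshold R n j (b k)%:R^-1
  (fun i => node (b k) j ^+ expo (b k) i)
  (fun i => node (b k) j.+1 ^+ expo (b k) i).
- by rewrite /n addn2 ltnS (leq_trans (ltn_ord j)).
- by rewrite invr_ge0 ltW.
- rewrite /b natrM invfM mulrCA -/n divff ?pnatr_eq0 ?mulr1 ?div1r//.
  by rewrite /n addn2.
- by move=> i; rewrite exprn_ge0// ltW//; case/andP: (x_itv j).
- move=> i; have /andP[h0 _] := x_itv j; have /andP[h1 _] := x_itv j.+1.
  by apply: lerXn2r; rewrite ?nnegrE; apply: ltW => //; exact: x_incr.
- by move=> i; case/andP: (x_itv j.+1) => h0 h1; rewrite exprn_ile1// ltW.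
- by move=> i ij; apply: node_expo_ge.
- by move=> i ij; apply: node_expo_le.
- exact: node_expo_ge.
- by move=> i ij; apply: node_expo_le.
move=> H1 H2.
have jk : Num.sqrt (j.+1%:R : R) <= Num.sqrt k%:R.
  by rewrite ler_wsqrtr// ler_nat.
apply: le_trans (inv_sqrt_gap _ _ _ _ _ H1 H2).
- by rewrite ler_pM2l ?lef_pV2 ?posrE ?sqrtr_gt0//; lra.
- by rewrite ler1n.
- by apply: gdetn_gt0 => //; rewrite expr2.
Qed.
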